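(* Let $\mathcal{E}_t$ and $\mathcal{D}_t$ be the series of flows and of small flows on rooted trees. Then $$\mathcal{D}_t=\Big(\sum_{n\ge0}\frac{\mathrm{Crl}_n}{n!}\Big)\diamond(\bullet,\mathcal{E}_t),$$ where $\mathrm{Crl}_n$ is the corolla with $n+1$ vertices (a root with $n$ leaves attached to it).
   Context: A rooted tree $T$ is a finite tree with a distinguished vertex (the root), edges oriented towards the root; $w\to v$ means that $w$ is a child of $v$. $\bullet$ is the one-vertex rooted tree. A flow on $T$ of size $k$ is a set $O$ of $k$ vertices (outputs) and a function $m:V(T)\to\mathbb{N}$ vanishing on $O$ (inputs with multiplicity are the vertices with $m>0$) such that the rates $r(v)\in\mathbb{Z}$ determined by $r(v)=m(v)-[v\in O]+\sum_{w\to v}r(w)$ are all $\ge 0$. The exit rate is $r(\mathrm{root})$. A flow is small if the root is neither an output nor an input. Let $\mathcal{E}_{T,t}=\sum b^{\text{size}}t^{\text{exit rate}}\in\mathbb{Q}[b][[t]]$ over all flows on $T$, $\mathcal{D}_{T,t}$ the same sum over all small flows on $T$, and $\mathcal{E}_t=\sum_T\mathcal{E}_{T,t}\,T/\mathrm{aut}(T)$, $\mathcal{D}_t=\sum_T\mathcal{D}_{T,t}\,T/\mathrm{aut}(T)$, sums over isomorphism classes of rooted trees, $\mathrm{aut}(T)$ being the number of automorphisms of $T$. **Operation $\diamond$ (from the Pre-Lie operad).** If $S$ is a rooted tree with vertex set $\{1,\dots,m\}$ and root $1$, and $T_1,\dots,T_m$ are rooted trees, let $S(T_1,\dots,T_m)$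 be the sum, over all ways to choose for each edge $i\to j$ of $S$ a vertex of $T_j$, of the rooted tree obtained from the disjoint union of the $T_i$ by joining, for each edge $i\to j$ of $S$, the root of $T_i$ to the chosen vertex of $T_j$; the root is that of $T_1$. This is extended multilinearly to formal series in each $T_i$. For series $t,u$ of rooted trees, $S\diamond(t,u)=S(t,u,\dots,u)$ ($t$ at the root, $u$ at all other vertices), extended linearly to series in $S$. *)

(* Defs.v *)
From HB Require Import structures.
From mathcomp Require Import all_boot all_order all_algebra.
From mathcomp Require Import finmap boolp classical_sets functions cardinality.
From mathcomp Require Import fsbigop.
From mathcomp Require Import finset.

Set Implicit Arguments.
Unset Strict Implicit.
Unset Printing Implicit Defensive.

Import GRing.Theory.
Local Open Scope ring_scope.
Local Open Scope quotient_scope.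

(* R[[t]]; fcoef f n is the coefficient of t^n.                               *)

Record fps (R : Type) := Fps { fcoef : nat -> R }.

HB.instance Definition _ (R : Type) := gen_eqMixin (fps R).
HB.instance Definition _ (R : Type) := gen_choiceMixin (fps R).

Lemma fpsP (R : Type) (f g : fps R) : fcoef f =1 fcoef g <-> f = g.
Proof.
split=> [|-> //]; case: f => f; case: g => g /= fg.
by congr Fps; apply: funext.
Qed.

Section FpsRing.
Variable R : comNzRingType.
Implicit Types f g h : fps R.

Definition fps0 : fps R := Fps (fun=> 0).
Definition fps1 : fps R := Fps (fun n => (n == 0)%:R).
Definition fps_opp f : fps R := Fps (fun n => - fcoef f n).
Definition fps_add f g : fps R := Fps (fun n => fcoef f n + fcoef g n).
Definition fps_mul f g : fps R :=
  Fps (fun n => \sum_(i < n.+1) fcoef f i * fcoef g (n - i)%N).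
Definition fps_scale (c : R) f : fps R := Fps (fun n => c * fcoef f n).

Let trunc N f : {poly R} := \poly_(i < N) fcoef f i.

Let truncE N f i : (i < N)%N -> (trunc N f)`_i = fcoef f i.
Proof. by move=> ltiN; rewrite coef_poly ltiN. Qed.

Let fps_mulE N f g n : (n < N)%N ->
  fcoef (fps_mul f g) n = (trunc N f * trunc N g)`_n.
Proof.
move=> ltnN; rewrite coefM; apply: eq_bigr => i _.
rewrite !truncE //; first by exact: leq_ltn_trans (leq_subr _ _) ltnN.
exact: leq_trans (ltn_ord i) ltnN.
Qed.

Fact fps_addA : associative fps_add.
Proof. by move=> f g h; apply/fpsP => n; exact: addrA. Qed.
Fact fps_addC : commutative fps_add.
Proof. by move=> f g; apply/fpsP => n; exact: addrC. Qed.
Fact fps_add0 : left_id fps0 fps_add.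
Proof. by move=> f; apply/fpsP => n; exact: add0r. Qed.
Fact fps_addN : left_inverse fps0 fps_opp fps_add.
Proof. by move=> f; apply/fpsP => n; exact: addNr. Qed.

HB.instance Definition _ :=
  GRing.isZmodule.Build (fps R) fps_addA fps_addC fps_add0 fps_addN.

Fact fps_mulC : commutative fps_mul.
Proof.
by move=> f g; apply/fpsP => n; rewrite !(fps_mulE _ _ (ltnSn n)) mulrC.
Qed.

Fact fps_mulA : associative fps_mul.
Proof.
move=> f g h; apply/fpsP => n.
have lt_n i : (n - i < n.+1)%N by rewrite ltnS leq_subr.
transitivity (trunc n.+1 f * (trunc n.+1 g * trunc n.+1 h))`_n.
  rewrite coefM; apply: eq_bigr => i _.
  by rewrite truncE // (fps_mulE _ _ (lt_n i)).
rewrite mulrA coefM; apply: eq_bigr => i _.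
by rewrite (truncE _ (lt_n i)) (fps_mulE _ _ (ltn_ord i)).
Qed.

Fact fps_mul1 : left_id fps1 fps_mul.
Proof.
move=> f; apply/fpsP => n /=.
by rewrite big_ord_recl /= mul1r subn0 big1 ?addr0 // => i _; rewrite mul0r.
Qed.

Fact fps_mulDl : left_distributive fps_mul fps_add.
Proof.
move=> f g h; apply/fpsP => n /=; rewrite -big_split /=.
by apply: eq_bigr => i _; rewrite mulrDl.
Qed.

Fact fps_1neq0 : fps1 != 0.
Proof.
apply/eqP => /(congr1 (fun f => fcoef f 0%N)) /= /eqP.
by rewrite oner_eq0.
Qed.

HB.instance Definition _ := GRing.Zmodule_isComNzRing.Build (fps R)
  fps_mulA fps_mulC fps_mul1 fps_mulDl fps_1neq0.

Fact fps_scaleA a b f : fps_scale a (fps_scale b f) = fps_scale (a * b) f.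
Proof. by apply/fpsP => n; exact: mulrA. Qed.
Fact fps_scale1 : left_id 1 fps_scale.
Proof. by move=> f; apply/fpsP => n; exact: mul1r. Qed.
Fact fps_scaleDr : right_distributive fps_scale +%R.
Proof. by move=> a f g; apply/fpsP => n; exact: mulrDr. Qed.
Fact fps_scaleDl f : {morph fps_scale^~ f : a b / a + b}.
Proof. by move=> a b; apply/fpsP => n; exact: mulrDl. Qed.

HB.instance Definition _ := GRing.Zmodule_isLmodule.Build R (fps R)
  fps_scaleA fps_scale1 fps_scaleDr fps_scaleDl.

End FpsRing.

(* Rooted trees with vertex set V.  The pair (w, v) \in arcs T is w -> v. A   *)
(* tree with all edges oriented towards the root r is a digraph in which      *)
(* every vertex has a path to r, every vertex but r has out-degree 1, and r   *)
(* has out-degree 0.                                                          *)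

Definition arc_rel (V : finType) (E : {set V * V}) : rel V :=
  fun w v => (w, v) \in E.

Definition is_rtree (V : finType) (x : V * {set V * V}) : bool :=
  [forall v, connect (arc_rel x.2) v x.1] &&
  [forall v, #|[set w | arc_rel x.2 v w]| == (v != x.1)].

Record rtree_on (V : finType) :=
  RTree { rtree_val : V * {set V * V}; rtree_valP : is_rtree rtree_val }.

HB.instance Definition _ (V : finType) := [isSub for @rtree_val V].
HB.instance Definition _ (V : finType) := [Finite of rtree_on V by <:].

Definition root (V : finType) (T : rtree_on V) : V := (rtree_val T).1.
Definition arcs (V : finType) (T : rtree_on V) : {set V * V} :=
  (rtree_val T).2.

Lemma root_connect (V : finType) (T : rtree_on V) v :
  connect (arc_rel (arcs T)) v (root T).
Proof. by have /andP[/forallP/(_ v)] := rtree_valP T. Qed.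

Lemma card_out (V : finType) (T : rtree_on V) v :
  #|[set w | arc_rel (arcs T) v w]| = (v != root T).
Proof. by have /andP[_ /forallP/(_ v)/eqP] := rtree_valP T. Qed.

Definition is_iso (V W : finType) (T : rtree_on V) (T' : rtree_on W)
    (f : {ffun V -> W}) : bool :=
  [&& injectiveb f, #|V| == #|W|, f (root T) == root T'
    & [forall w, forall v, ((f w, f v) \in arcs T') == ((w, v) \in arcs T)]].

Definition iso (V W : finType) (T : rtree_on V) (T' : rtree_on W) : bool :=
  [exists f, is_iso T T' f].

Definition aut (V : finType) (T : rtree_on V) : nat :=
  #|[set f : {ffun V -> V} | is_iso T T f]|.

Lemma isoP (V W : finType) (T : rtree_on V) (T' : rtree_on W) :
  reflect (exists f : V -> W, [/\ bijective f, f (root T) = root T'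
    & forall w v, ((f w, f v) \in arcs T') = ((w, v) \in arcs T)])
  (iso T T').
Proof.
apply: (iffP existsP) => [[f /and4P[/injectiveP injf /eqP eqVW /eqP fr /forallP fE]]|].
  exists f; split=> //; first by apply: inj_card_bij; rewrite ?eqVW.
  by move=> w v; have /forallP/(_ v)/eqP := fE w.
move=> [f [bijf fr fE]]; exists (finfun f); apply/and4P; split.
- by apply/injectiveP => x y; rewrite !ffunE; exact: bij_inj.
- by rewrite (bij_eq_card bijf).
- by rewrite ffunE fr.
- by apply/forallP => w; apply/forallP => v; rewrite !ffunE fE.
Qed.

Lemma iso_refl (V : finType) (T : rtree_on V) : iso T T.
Proof. by apply/isoP; exists id; split=> //; exists id. Qed.

Lemma iso_sym_imp (V W : finType) (T : rtree_on V) (T' : rtree_on W) :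
  iso T T' -> iso T' T.
Proof.
case/isoP => f [[g fK gK] fr fE]; apply/isoP; exists g; split.
- by exists f.
- by rewrite -fr fK.
- by move=> w v; rewrite -fE !gK.
Qed.

Lemma iso_sym (V W : finType) (T : rtree_on V) (T' : rtree_on W) :
  iso T T' = iso T' T.
Proof. by apply/idP/idP; exact: iso_sym_imp. Qed.

Lemma iso_trans (U V W : finType) (T : rtree_on U) (T' : rtree_on V)
  (T'' : rtree_on W) : iso T T' -> iso T' T'' -> iso T T''.
Proof.
case/isoP => f [bf fr fE] /isoP[g [bg gr gE]]; apply/isoP.
exists (g \o f); split; first exact: bij_comp.
- by rewrite /= fr.
- by move=> w v; rewrite /= gE fE.
Qed.

Lemma iso_card (V W : finType) (T : rtree_on V) (T' : rtree_on W) :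
  iso T T' -> #|V| = #|W|.
Proof. by case/isoP => f [bf _ _]; exact: bij_eq_card bf. Qed.

(* A rooted tree is nonempty, so the trees with vertex set {0, ..., n}, up to *)
(* isomorphism, represent all isomorphism classes.                            *)

Definition ord_rtree := {n : nat & rtree_on 'I_n.+1}.

HB.instance Definition _ := Countable.on ord_rtree.

Definition ord_iso : rel ord_rtree := fun T T' => iso (tagged T) (tagged T').

Fact ord_iso_refl : reflexive ord_iso.
Proof. by move=> T; exact: iso_refl. Qed.
Fact ord_iso_sym : symmetric ord_iso.
Proof. by move=> T T'; exact: iso_sym. Qed.
Fact ord_iso_trans : transitive ord_iso.
Proof. by move=> T' T T''; exact: iso_trans. Qed.

Canonical ord_iso_equiv :=
  EquivRel ord_iso ord_iso_refl ord_iso_sym ord_iso_trans.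

Definition rtree := {eq_quot ord_iso}.

HB.instance Definition _ := Choice.on rtree.
HB.instance Definition _ := EqQuotient.on rtree.

Definition vert (T : rtree) : finType := 'I_(tag (repr T)).+1.

Definition rep (T : rtree) : rtree_on (vert T) := tagged (repr T).

Definition class n (T : rtree_on 'I_n.+1) : rtree :=
  \pi_rtree (existT (fun k => rtree_on 'I_k.+1) n T).

Definition corolla_val n : 'I_n.+1 * {set 'I_n.+1 * 'I_n.+1} :=
  (ord0, [set a | (a.1 != ord0) && (a.2 == ord0)]).

Fact corolla_is_rtree n : is_rtree (corolla_val n).
Proof.
apply/andP; split; apply/forallP => v /=.
  have [->|v0] := eqVneq v ord0; first exact: connect0.
  by apply: connect1; rewrite /arc_rel inE /= v0 eqxx.
have -> : [set w | arc_rel (corolla_val n).2 v w] =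
          if v != ord0 then [set ord0] else set0.
  by apply/setP => w; rewrite inE /arc_rel inE /=; case: (v != ord0); rewrite inE.
by case: (v != ord0); rewrite ?cards1 ?cards0.
Qed.

Definition corolla n : rtree := class (RTree (corolla_is_rtree n)).

Fact bullet_is_rtree : is_rtree (ord0 : 'I_1, set0 : {set 'I_1 * 'I_1}).
Proof.
apply/andP; split; apply/forallP => v /=; rewrite !ord1 ?connect0 // eqxx.
by rewrite cards_eq0; apply/eqP/setP => w; rewrite inE /arc_rel !inE.
Qed.

Definition bullet : rtree := class (RTree bullet_is_rtree).

(* A preflow is a triple (O, m, r).  By rate_exists_unique the rates r of a   *)
(* flow are determined by (O, m), so that counting the triples amounts to     *)
(* counting the pairs (O, m).                                                 *)

Definition preflow (V : finType) : Type :=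
  {set V} * {ffun V -> nat} * {ffun V -> int}.

HB.instance Definition _ (V : finType) := Choice.on (preflow V).

Definition outputs (V : finType) (F : preflow V) : {set V} := F.1.1.
Definition inputs (V : finType) (F : preflow V) : {ffun V -> nat} := F.1.2.
Definition rate (V : finType) (F : preflow V) : {ffun V -> int} := F.2.

Definition is_rate (V : finType) (T : rtree_on V) (F : preflow V) : bool :=
  [forall v, rate F v == (inputs F v)%:Z - (v \in outputs F)%:Z
                         + \sum_(w | arc_rel (arcs T) w v) rate F w].

Definition is_flow (V : finType) (T : rtree_on V) (F : preflow V) : bool :=
  [&& [forall v in outputs F, inputs F v == 0%N], is_rate T F
    & [forall v, 0 <= rate F v]].

Definition exit_rate (V : finType) (T : rtree_on V) (F : preflow V) : int :=
  rate F (root T).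

Definition is_small (V : finType) (T : rtree_on V) (F : preflow V) : bool :=
  (root T \notin outputs F) && (inputs F (root T) == 0%N).

(* The defining recursion determines the rates: it goes up from the leaves.   *)

Lemma depth_exists (V : finType) (T : rtree_on V) :
  exists d : V -> nat, forall w v, arc_rel (arcs T) w v -> d w = (d v).+1.
Proof.
pose par v := odflt v [pick w | arc_rel (arcs T) v w].
have parE w v : arc_rel (arcs T) w v -> (w != root T) && (par w == v).
  move=> wv; have := card_out T w; rewrite (cardsD1 v) inE wv.
  case: eqP => //= _ [/eqP]; rewrite cards_eq0 => /eqP/setP uniq_v.
  rewrite /par; case: pickP => [u wu|/(_ v)]; last by rewrite wv.
  by have := uniq_v u; rewrite !inE wu andbT => /negbFE.
have reach v : exists k, iter k par v == root T.
  case/connectP: (root_connect T v) => p; elim: p v => [|u p IHp] v /=.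
    by move=> _ ->; exists 0%N.
  case/andP=> /parE/andP[_ /eqP vu] up def_r.
  by have [k kP] := IHp u up def_r; exists k.+1; rewrite iterSr vu.
exists (fun v => ex_minn (reach v)) => w v /parE/andP[wr /eqP wv].
case: ex_minnP => -[|k] kP kmin; first by case/eqP: wr; exact/eqP.
case: ex_minnP => l lP lmin; congr _.+1.
rewrite iterSr wv in kP; apply/eqP; rewrite eqn_leq lmin // andbT.
by rewrite -ltnS kmin // iterSr wv.
Qed.

Lemma rate_exists_unique (V : finType) (T : rtree_on V) (O : {set V})
    (m : {ffun V -> nat}) : exists! r, is_rate T (O, m, r).
Proof.
have [d dP] := depth_exists T; pose N := (\max_v d v)%N.
have dN v : (d v <= N)%N by exact: leq_bigmax.
pose net v : int := (m v)%:Z - (v \in O)%:Z.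
have [rec recE] : exists rec : nat -> V -> int, forall k v,
    rec k.+1 v = net v + \sum_(w | arc_rel (arcs T) w v) rec k w.
  exists (fix rec (k : nat) (v : V) {struct k} : int :=
    if k is k'.+1 then net v + \sum_(w | arc_rel (arcs T) w v) rec k' w
    else 0).
  by [].
have recS k v : (N < k + d v)%N -> rec k.+1 v = rec k v.
  elim: k v => [|k IHk] v ltN; first by have := leq_trans ltN (dN v); rewrite ltnn.
  rewrite !recE; congr (_ + _); apply: eq_bigr => w wv.
  by apply: IHk; rewrite (dP w v wv) addnS.
exists [ffun v => rec N.+1 v]; split=> [|r /forallP rP].
  apply/forallP => v; rewrite ffunE -recS ?leq_addr // recE.
  by apply/eqP; congr (_ + _); apply: eq_bigr => w _; rewrite ffunE.
suff recr k v : (N < k + d v)%N -> rec k v = r v.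
  by apply/ffunP => v; rewrite ffunE recr // leq_addr.
elim: k v => [|k IHk] v ltN; first by have := leq_trans ltN (dN v); rewrite ltnn.
rewrite recE; have /eqP/= -> := rP v.
congr (_ + _); apply: eq_bigr => w wv; apply: IHk.
by rewrite (dP w v wv) addnS.
Qed.

Lemma exit_rateE (V : finType) (T : rtree_on V) (F : preflow V) :
  is_rate T F -> exit_rate T F = (\sum_v inputs F v)%:Z - #|outputs F|%:Z.
Proof.
move=> /forallP rP.
have eq_r : \sum_v rate F v = \sum_v ((inputs F v)%:Z - (v \in outputs F)%:Z)
    + \sum_(w | w != root T) rate F w.
  transitivity (\sum_v ((inputs F v)%:Z - (v \in outputs F)%:Z
                   + \sum_(w | arc_rel (arcs T) w v) rate F w)).
    by apply: eq_bigr => v _; exact/eqP.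
  rewrite big_split /=; congr (_ + _).
  rewrite (exchange_big_dep xpredT) //= [RHS]big_mkcond /=.
  apply: eq_bigr => w _; rewrite big_const -Monoid.iteropE /=.
  have -> : #|[pred v | arc_rel (arcs T) w v]| = (w != root T).
    by rewrite -card_out; apply: eq_card => v; rewrite !inE.
  by case: (w != root T).
move: eq_r; rewrite (bigD1 (root T)) //= => /addIr.
rewrite /exit_rate => ->; rewrite sumrB; congr (_ - _).
  by rewrite -[RHS]natz natr_sum; apply: eq_bigr => v _; rewrite natz.
rewrite -sum1_card -[RHS]natz natr_sum [RHS]big_mkcond /=.
by apply: eq_bigr => v _; case: (v \in _).
Qed.

Lemma finite_image_finType (I : finType) (X : Type) (f : I -> X)
    (A : X -> Prop) :
  (forall x, A x -> exists i, x = f i) -> finite_set [set x | A x]%classic.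
Proof.
move=> Af; apply: (@sub_finite_set _ _ (f @` [set: I])%classic).
  by move=> x /Af[i ->]; exists i.
exact/finite_image/finite_finset.
Qed.

Lemma finite_flows (V : finType) (T : rtree_on V) (e : nat) :
  finite_set [set F | is_flow T F && (exit_rate T F == e%:Z)]%classic.
Proof.
have R O m : {r | is_rate T (O, m, r)}.
  by apply/cid; have [r [rP _]] := rate_exists_unique T O m; exists r.
pose M := (e + #|V|)%N.
pose I : finType := ({set V} * {ffun V -> 'I_M.+1})%type.
pose f (x : I) : preflow V :=
  let m := [ffun v => val (x.2 v)] in (x.1, m, sval (R x.1 m)).
apply: (@finite_image_finType I (preflow V) f).
move=> [[O m] r] /andP[/and3P[_ rP _] /eqP exitF].
have := exit_rateE rP; rewrite exitF => /eqP.
rewrite /inputs /outputs /= eq_sym subr_eq -PoszD => /eqP[sum_m].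
have ltm v : (m v < M.+1)%N.
  rewrite ltnS; apply: leq_trans (leq_add (leqnn e) (max_card (mem O))).
  by rewrite -sum_m (bigD1 v) //= leq_addr.
exists (O, [ffun v => Ordinal (ltm v)]); rewrite /f /=.
have -> : [ffun v => val ([ffun v => Ordinal (ltm v)] v)] = m.
  by apply/ffunP => v; rewrite !ffunE.
congr (_, _); have [r' [_ r'U]] := rate_exists_unique T O m.
by rewrite -(r'U _ rP) (r'U _ (svalP (R O m))).
Qed.

(* Q[b][[t]], where b is 'X.                                                  *)

Notation coefs := (fps {poly rat}).

(* The coefficients of a series sum_T (f T) T over isomorphism classes.       *)
Definition tseries : Type := rtree -> coefs.

Definition tree (T : rtree) : tseries := fun U => (U == T)%:R.

(* A sum \sum_(_ \in _) is by convention 0 if its support is infinite: this   *)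
(* never happens here nor in the other sums below (finite_flows,              *)
(* finite_apply, finite_diamond, finite_corolla).                             *)
Definition gen_flows (V : finType) (T : rtree_on V) (P : pred (preflow V)) :
    coefs :=
  Fps (fun e => \sum_(F \in [set F | [&& is_flow T F, P F
                                      & exit_rate T F == e%:Z]]%classic)
                  ('X^#|outputs F| : {poly rat})).

Definition flows (V : finType) (T : rtree_on V) : coefs :=
  gen_flows T xpredT.
Definition small_flows (V : finType) (T : rtree_on V) : coefs :=
  gen_flows T (is_small T).

Definition flow_series : tseries :=
  fun T => ((aut (rep T))%:R^-1)%:P *: flows (rep T).
Definition small_flow_series : tseries :=
  fun T => ((aut (rep T))%:R^-1)%:P *: small_flows (rep T).

Lemma Tagged_inj (I : eqType) (W : I -> eqType) i : injective (@Tagged I i W).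
Proof. by move=> x y /eqP; rewrite -tag_eqE /tag_eq /= eqxx tagged_asE => /eqP. Qed.

Section Graft.
Variables (V : finType) (S : rtree_on V).
Variables (W : V -> finType) (T : forall i, rtree_on (W i)).

Definition graft_choice : finType :=
  {dffun forall e : {e : V * V | e \in arcs S}, W (val e).2}.

Definition graft_arcs (f : graft_choice) :
    {set {i : V & W i} * {i : V & W i}} :=
  (\bigcup_i [set (Tagged W a.1, Tagged W a.2) | a in arcs (T i)]) :|:
  [set (Tagged W (root (T (val e).1)), Tagged W (f e))
    | e : {e : V * V | e \in arcs S}].

Definition graft_val (f : graft_choice) :=
  (Tagged W (root (T (root S))), graft_arcs f).

Lemma in_graft_arcs (f : graft_choice) i (x : W i) (b : {i : V & W i}) :
  reflect ((exists2 y, (x, y) \in arcs (T i) & b = Tagged W y) \/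
           (exists2 e : {e : V * V | e \in arcs S},
              Tagged W x = Tagged W (root (T (val e).1)) & b = Tagged W (f e)))
    ((Tagged W x, b) \in graft_arcs f).
Proof.
rewrite inE; apply: (iffP orP) => -[].
- case/bigcupP=> j _ /imsetP[[x' y] /= xy] [eij xx' ->]; left.
  move: x xx'; rewrite {}eij => x xx'; exists y => //.
  by rewrite (Tagged_inj xx').
- by case/imsetP=> e _ [eij xx' ->]; right; exists e => //; rewrite -xx'.
- case=> y xy ->; left; apply/bigcupP; exists i => //.
  by apply/imsetP; exists (x, y).
- by case=> e -> ->; right; apply/imsetP; exists e.
Qed.

Fact graft_is_rtree (f : graft_choice) : is_rtree (graft_val f).
Proof.
have inE1 i (x y : W i) : connect (arc_rel (arcs (T i))) x y ->
    connect (arc_rel (graft_arcs f)) (Tagged W x) (Tagged W y).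
  case/connectP=> p; elim: p x => [|z p IHp] x /=.
    by move=> _ ->; exact: connect0.
  case/andP=> xz zp def_y; apply: connect_trans (IHp z zp def_y).
  by apply: connect1; apply/in_graft_arcs; left; exists z.
apply/andP; split; apply/forallP => -[i x] /=.
  apply: connect_trans (inE1 i x _ (root_connect _ _)) _ => {x}.
  case/connectP: (root_connect S i) => p; elim: p i => [|j p IHp] i /=.
    by move=> _ ->; exact: connect0.
  case/andP=> ij jp def_r; apply: connect_trans (IHp j jp def_r).
  pose e : {e : V * V | e \in arcs S} := Sub (i, j) ij.
  apply: connect_trans (inE1 j (f e) _ (root_connect _ _)).
  by apply: connect1; apply/in_graft_arcs; right; exists e.
apply/eqP; have cT := card_out (T i) x; have cS := card_out S i.
have [xr | xNr] := eqVneq x (root (T i)); last first.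
  have -> : Tagged W x != Tagged W (root (T (root S))).
    apply: contraNneq xNr => eq_xr; have /= ei := congr1 (@tag _ _) eq_xr.
    by clear cT; move: x eq_xr; rewrite ei => x /Tagged_inj ->.
  move: cT; rewrite xNr => /eqP/cards1P[y def_y].
  apply/eqP/cards1P; exists (Tagged W y); apply/setP => b; rewrite !inE.
  apply/in_graft_arcs/eqP => [[] | ->].
  - by case=> z xz ->; have := in_set1 z y; rewrite -def_y inE [LHS]xz => /esym/eqP->.
  - case=> e eq_xr _; case/eqP: xNr; have /= ei := congr1 (@tag _ _) eq_xr.
    move: x eq_xr {y def_y}; rewrite ei => x; exact: Tagged_inj.
  left; exists y => //.
  by have := set11 y; rewrite -def_y inE.
have noT y : (x, y) \in arcs (T i) = false.
  move: cT; rewrite xr eqxx => /eqP; rewrite cards_eq0 => /eqP/setP/(_ y).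
  by rewrite !inE.
have [iS | iNS] := eqVneq i (root S).
  have -> : (Tagged W x != Tagged W (root (T (root S)))) = false.
    by move: x xr {cT noT}; rewrite iS => x ->; rewrite eqxx.
  apply/eqP; rewrite cards_eq0; apply/eqP/setP => b; rewrite !inE.
  apply/in_graft_arcs => -[[y]|[[[j k] /= jk]]]; first by rewrite noT.
  move/(congr1 (@tag _ _)) => /= ij _. move: cS; rewrite iS eqxx => /eqP.
  rewrite cards_eq0 -iS ij => /eqP/setP/(_ k); rewrite !inE.
  by rewrite /arc_rel; move=> jk0; rewrite jk in jk0.
have -> : Tagged W x != Tagged W (root (T (root S))).
  by apply: contra iNS => /eqP/(congr1 (@tag _ _)) /= ->.
move: cS; rewrite iNS => /eqP/cards1P[j def_j].
have ij : (i, j) \in arcs S by have := set11 j; rewrite -def_j inE.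
pose e : {e : V * V | e \in arcs S} := Sub (i, j) ij.
apply/eqP/cards1P; exists (Tagged W (f e)); apply/setP => b; rewrite !inE.
apply/in_graft_arcs/eqP => [[[y]|[e' xe' ->]]| ->].
- by rewrite noT.
- suff -> : e' = e by [].
  apply: val_inj; case: e' xe' => -[i' j'] /= ij' /(congr1 (@tag _ _)) /= ii'.
  by have := in_set1 j' j; rewrite -def_j inE ii' [LHS]ij' => /esym/eqP->.
- by right; exists e => //; rewrite xr.
Qed.

Definition graft (f : graft_choice) : rtree_on {i : V & W i} :=
  RTree (graft_is_rtree f).

End Graft.

(* The coefficient of U in S(T_1, ..., T_m), the T_i being single trees.       *)
Definition graft_coef (V : finType) (S : rtree_on V) (T : V -> rtree)
    (U : rtree) : nat :=
  #|[set f : graft_choice S (fun i => vert (T i))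
      | iso (graft (fun i => rep (T i)) f) (rep U)]|.

(* The series S(a_1, ..., a_m), the a_i being series.                         *)
Definition apply (V : finType) (S : rtree_on V) (a : V -> tseries) : tseries :=
  fun U => \sum_(T \in [set: {ffun V -> rtree}]%classic)
    (\prod_i a i (T i)) *+ graft_coef S T U.

Definition diamond (s t u : tseries) : tseries :=
  fun U => \sum_(S \in [set: rtree]%classic)
    s S * apply (rep S) (fun i => if i == root (rep S) then t else u) U.

Definition corolla_series : tseries :=
  fun U => \sum_(n \in [set: nat]%classic) (n`!%:R^-1)%:P *: tree (corolla n) U.

Definition small_class N (x : {n : 'I_N & rtree_on 'I_n.+1}) : rtree :=
  class (tagged x).

Lemma small_classP N (T : rtree) : (#|vert T| <= N)%N ->
  exists x : {n : 'I_N & rtree_on 'I_n.+1}, T = small_class x.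
Proof.
rewrite card_ord => leN.
exists (Tagged (fun n : 'I_N => rtree_on 'I_n.+1) (rep T : rtree_on 'I_(Ordinal leN).+1)).
rewrite /small_class /class /= /rep -[LHS]reprK; congr \pi.
by case: (repr T).
Qed.

Lemma graft_coef_neq0 (V : finType) (S : rtree_on V) (T : V -> rtree) U :
  graft_coef S T U != 0%N -> (#|vert U| = \sum_i #|vert (T i)|)%N.
Proof.
rewrite -lt0n => /card_gt0P[f]; rewrite inE => /iso_card <-.
by rewrite card_tagged sumnE big_map big_enum.
Qed.

Lemma apply_term_neq0 (V : finType) (S : rtree_on V) (c : coefs) T U :
  c *+ graft_coef S T U != 0 -> (#|vert U| = \sum_i #|vert (T i)|)%N.
Proof.
move=> cT; apply: (@graft_coef_neq0 _ S); apply: contraNneq cT => ->.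
by rewrite mulr0n.
Qed.

Lemma finite_apply (V : finType) (S : rtree_on V) (a : V -> tseries) U :
  finite_set [set T : {ffun V -> rtree} |
    (\prod_i a i (T i)) *+ graft_coef S T U != 0]%classic.
Proof.
pose X : finType := {n : 'I_#|vert U| & rtree_on 'I_n.+1}.
apply: (@finite_image_finType {ffun V -> X} _
  (fun h => [ffun i => small_class (h i)])) => T /apply_term_neq0 sumT.
have smallT i : {x : X | T i = small_class x}.
  by apply/cid/small_classP; rewrite sumT (bigD1 i) //= leq_addr.
exists [ffun i => sval (smallT i)]; apply/ffunP => i.
by rewrite !ffunE; exact: svalP (smallT i).
Qed.

Lemma finite_diamond (s t u : tseries) U :
  finite_set [set S | s S *
    apply (rep S) (fun i => if i == root (rep S) then t else u) U != 0]%classic.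
Proof.
apply: (@finite_image_finType _ _ (@small_class #|vert U|)) => S Sneq0.
apply: small_classP; move: Sneq0; apply: contraNT; rewrite -ltnNge => ltS.
rewrite /apply fsbig1 ?mulr0 // => T _; apply/eqP; apply: contraTT ltS.
move/apply_term_neq0 => ->; rewrite -leqNgt -sum1_card leq_sum // => i _.
by rewrite card_ord.
Qed.

Lemma finite_corolla U : finite_set [set n | U == corolla n]%classic.
Proof.
apply: (@finite_image_finType unit _ (fun=> #|vert U|.-1)) => n /eqP ->.
exists tt; pose T := existT (fun k => rtree_on 'I_k.+1) n
  (RTree (corolla_is_rtree n)).
have : ord_iso (repr (corolla n)) T.
  by rewrite -(@eqmodE _ ord_iso_equiv) reprK.
by move/iso_card; rewrite /vert !card_ord => ->.
Qed.

(* Main.v *)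
From mathcomp Require Import all_boot all_order all_algebra.
From mathcomp Require Import finmap boolp classical_sets functions cardinality.
From mathcomp Require Import fsbigop.
From mathcomp Require Import finset.
Require Import Defs.

Set Implicit Arguments.
Unset Strict Implicit.
Unset Printing Implicit Defensive.

Import GRing.Theory Num.Theory.
Local Open Scope ring_scope.

(** The coefficient of a tree [U] in the right-hand side is computed for one
    corolla at a time.  Let [B_c], for [c] in a finite set [C], be the branches of
    [U], that is the trees hanging from the children of its root
    ([exists_bplus]).

    Grafting trees [T_1, ..., T_n] on the leaves of the corolla with [n] leaves,
    with the one-vertex tree at its root, can be done in only one way and yields
    the tree [bplus T] that joins the [T_i] to a new root ([graft_coef_star]).  So
    the coefficient is 1/n! times the sum, over the families [T] such that
    [bplus T] is isomorphic to [U], of the product of the E_(T_i) / aut(T_i).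
    After multiplication by aut(U) this is a sum over pairs of a family [T] and an
    isomorphism from [bplus T] to [U].  Such an isomorphism amounts to a bijection
    [s] from the leaves to [C] together with an isomorphism from each [T_i] to
    [B_(s i)] ([card_isos_bplus]).  Summing over [s] first, the family [T] is
    determined by [s], the number of isomorphisms from [T_i] to [B_(s i)] cancels
    1 / aut(T_i) ([flow_series_isos]), and what remains is the product of the
    E_(B_c) for each [s] ([apply_star]).  Counting matchings rather than unordered
    families avoids any discussion of isomorphic branches.  There are n! bijections
    when n is the number of branches, and none otherwise, so only that corolla
    contributes and n! cancels.

    It remains to see that the product of the E_(B_c) is D_U
    ([small_flows_bplus]).  A small flow on [U] is a free choice of a flow on each
    branch, the root only collecting what the branches emit; sizes and exit rates
    are additive, so the generating series multiply ([prod_gen_series]). *)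

(** * Paths in rooted trees *)

Lemma inj_surj_bij (A B : Type) (f : A -> B) :
  injective f -> (forall y, exists x, f x = y) -> bijective f.
Proof.
move=> f_inj /choice[g gK]; exists g => // x.
exact: f_inj.
Qed.

Lemma homo_connect (A B : finType) (e : rel A) (e' : rel B) (f : A -> B) :
  {homo f : x y / e x y >-> e' x y} ->
  {homo f : x y / connect e x y >-> connect e' x y}.
Proof.
move=> f_homo x y /connectP[p]; elim: p x => [|z p IHp] x /=.
  by move=> _ ->; exact: connect0.
case/andP=> xz zp def_y; apply: connect_trans (IHp z zp def_y).
by apply: connect1; exact: f_homo.
Qed.

Section RtreeTheory.
Variables (V : finType) (T : rtree_on V).

Lemma arc_functional v w w' :
  (v, w) \in arcs T -> (v, w') \in arcs T -> w = w'.
Proof.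
move=> vw vw'; have: (#|[set w | arc_rel (arcs T) v w]| <= 1)%N.
  by rewrite card_out leq_b1.
move/card_le1P/(_ w); rewrite inE => /(_ vw w').
by rewrite !inE /arc_rel vw' => /esym/eqP.
Qed.

Lemma root_no_arc w : (root T, w) \notin arcs T.
Proof.
apply/negP => rw; have := card_out T (root T); rewrite eqxx => /eqP.
by rewrite cards_eq0 => /eqP/setP/(_ w); rewrite !inE /arc_rel rw.
Qed.

(** Out-degrees are at most one, so the vertices on the way from [v] to the
    root form a chain; this is what makes the branches of a tree disjoint. *)
Lemma connect_chain v a b :
  connect (arc_rel (arcs T)) v a -> connect (arc_rel (arcs T)) v b ->
  connect (arc_rel (arcs T)) a b \/ connect (arc_rel (arcs T)) b a.
Proof.
case/connectP=> p; elim: p v => [|u p IHp] v /=; first by move=> _ ->; left.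
case/andP=> vu up def_a vb.
case/connectP: (vb) => -[_ ->|w q] /=.
  by right; apply/connectP; exists (u :: p); rewrite //= vu.
case/andP=> vw wq def_b; apply: (IHp u) => //.
by apply/connectP; exists q; rewrite // (arc_functional vu vw).
Qed.

Lemma connect_root v : connect (arc_rel (arcs T)) (root T) v -> v = root T.
Proof.
case/connectP=> -[_ ->//|w p] /= /andP[rw _].
by have := root_no_arc w; rewrite [_ \in _]rw.
Qed.

End RtreeTheory.

Lemma is_rtreeI (V : finType) (r : V) (E : {set V * V}) :
  (forall v, connect (arc_rel E) v r) ->
  (forall v w w', (v, w) \in E -> (v, w') \in E -> w = w') ->
  (forall w, (r, w) \notin E) -> is_rtree (r, E).
Proof.
move=> conn func noarc; apply/andP; split; apply/forallP => v //=.
have [->|vr] := eqVneq v r.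
  rewrite cards_eq0; apply/eqP/setP => w; rewrite !inE.
  exact/negbTE/noarc.
case/connectP: (conn v) => -[_ def_r|w p]; first by rewrite def_r eqxx in vr.
case/andP=> vw _ _; apply/cards1P; exists w; apply/setP => u; rewrite !inE.
by apply/idP/eqP => [vu|-> //]; exact: func vu vw.
Qed.

(** * Counting isomorphisms *)

Lemma is_isoP (V W : finType) (T : rtree_on V) (T' : rtree_on W)
    (f : {ffun V -> W}) :
  reflect [/\ bijective f, f (root T) = root T'
    & forall w v, ((f w, f v) \in arcs T') = ((w, v) \in arcs T)]
  (is_iso T T' f).
Proof.
apply: (iffP and4P) => [[/injectiveP injf /eqP eqVW /eqP fr /forallP fE]|[bijf fr fE]].
  split=> //; first by apply: inj_card_bij; rewrite ?eqVW.
  by move=> w v; have /forallP/(_ v)/eqP := fE w.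
split; rewrite ?fr ?(bij_eq_card bijf) //; first exact/injectiveP/bij_inj.
by apply/forallP => w; apply/forallP => v; rewrite fE.
Qed.

Section Isos.
Variables (V W : finType) (T : rtree_on V) (T' : rtree_on W).

Definition isos : {set {ffun V -> W}} := [set f | is_iso T T' f].

Lemma isos_gt0 : (0 < #|isos|)%N = iso T T'.
Proof.
by apply/card_gt0P/existsP => -[f fP]; exists f; move: fP; rewrite inE.
Qed.

End Isos.

(** Composing with isomorphisms on both sides is injective. *)
Lemma card_isos_leq (V V' W W' : finType) (T : rtree_on V) (T' : rtree_on V')
    (U : rtree_on W) (U' : rtree_on W') :
  iso T T' -> iso U U' -> (#|isos T U| <= #|isos T' U'|)%N.
Proof.
case/isoP=> g [[h gK hK] gr gE] /isoP[k [k_bij kr kE]].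
pose conj (f : {ffun V -> W}) : {ffun V' -> W'} := [ffun v => k (f (h v))].
have conj_inj : injective conj.
  move=> f f' /ffunP ff'; apply/ffunP => v; apply: (bij_inj k_bij).
  by have := ff' (g v); rewrite !ffunE gK.
rewrite -(card_imset _ conj_inj); apply/subset_leq_card/fintype.subsetP.
move=> _ /imsetP[f + ->].
rewrite !inE => /is_isoP[f_bij fr fE]; apply/is_isoP; split.
- apply: (@eq_bij _ _ (k \o (f \o h))); last by move=> v; rewrite ffunE.
  by apply/(bij_comp k_bij)/(bij_comp f_bij); exists g.
- by rewrite ffunE -gr gK fr.
- by move=> w v; rewrite !ffunE kE fE -gE !hK.
Qed.

Lemma card_isos_eq (V V' W W' : finType) (T : rtree_on V) (T' : rtree_on V')
    (U : rtree_on W) (U' : rtree_on W') :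
  iso T T' -> iso U U' -> #|isos T U| = #|isos T' U'|.
Proof.
by move=> TT' UU'; apply/eqP; rewrite eqn_leq !card_isos_leq // iso_sym.
Qed.

Lemma card_isos_aut (V W : finType) (T : rtree_on V) (U : rtree_on W) :
  iso T U -> #|isos T U| = aut U.
Proof. by move=> TU; exact: card_isos_eq TU (iso_refl U). Qed.

(** * Grafting a family of trees on a new root *)

Section Bplus.
Variables (J : finType) (W : J -> finType) (T : forall j, rtree_on (W j)).

Definition bplus_arc (a : option {j & W j} * option {j & W j}) : bool :=
  match a with
  | (Some u, Some v) =>
      (tag u == tag v) && ((tagged u, tagged_as u v) \in arcs (T (tag u)))
  | (Some u, None) => tagged u == root (T (tag u))
  | (None, _) => false
  end.

Definition bplus_val : option {j & W j} * {set option {j & W j} * option {j & W j}} :=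
  (None, [set a | bplus_arc a]).

Lemma bplus_arc_branch j (x y : W j) :
  bplus_arc (Some (Tagged W x), Some (Tagged W y)) = ((x, y) \in arcs (T j)).
Proof. by rewrite /= eqxx tagged_asE. Qed.

Fact bplus_is_rtree : is_rtree bplus_val.
Proof.
apply: is_rtreeI => [[[j x]|]|u v w|v]; last by rewrite inE.
- apply: (@connect_trans _ _ (Some (Tagged W (root (T j))))).
    apply: (homo_connect (f := fun x => Some (Tagged W x)))
      (root_connect (T j) x) => y z yz.
    by rewrite /arc_rel inE bplus_arc_branch.
  by apply: connect1; rewrite /arc_rel inE /= eqxx.
- exact: connect0.
rewrite !inE; case: u v w => [[j x]|//] [[k y]|] [[l z]|] //.
- move=> /andP[/eqP/= jk +] /andP[/eqP/= jl].
  move: y z; rewrite -{}jk -{}jl => y z; rewrite !tagged_asE /= => xy xz.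
  by rewrite (arc_functional xy xz).
- move=> /andP[/eqP/= jk +] /= /eqP xr; move: y; rewrite -{}jk => y.
  by rewrite tagged_asE xr /= (negbTE (root_no_arc _ _)).
- move=> /= /eqP xr /andP[/eqP/= jk]; move: z; rewrite -{}jk => z.
  by rewrite tagged_asE xr /= (negbTE (root_no_arc _ _)).
Qed.

(** The operator usually written B+, with [None] as the new root: unlike a graft
    along a corolla, it depends on the branches only. *)
Definition bplus : rtree_on (option {j & W j}) := RTree bplus_is_rtree.

Lemma bplus_arcE u v : ((u, v) \in arcs bplus) = bplus_arc (u, v).
Proof. by rewrite inE. Qed.

Lemma bplus_branchE j (x y : W j) :
  ((Some (Tagged W x), Some (Tagged W y)) \in arcs bplus) = ((x, y) \in arcs (T j)).
Proof. by rewrite bplus_arcE bplus_arc_branch. Qed.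

Lemma bplus_rootE j (x : W j) :
  ((Some (Tagged W x), None) \in arcs bplus) = (x == root (T j)).
Proof. by rewrite bplus_arcE. Qed.

End Bplus.
Lemma big_inj (R : Type) (idx : R) (op : Monoid.com_law idx) (I J : finType)
    (h : I -> J) (P : pred J) (F : J -> R) :
  injective h -> (forall j, P j -> exists i, h i = j) ->
  \big[op/idx]_(j | P j) F j = \big[op/idx]_(i | P (h i)) F (h i).
Proof.
move=> h_inj h_surj; pose h' j := [pick i | h i == j].
have hK i : h' (h i) = Some i.
  rewrite /h'; case: pickP => [i' /eqP/h_inj -> //|/(_ i)].
  by rewrite eqxx.
rewrite (reindex_omap h h') => [|j /h_surj[i <-]]; last by rewrite hK.
by apply: eq_bigl => i; rewrite hK eqxx andbT.
Qed.

Lemma card_dffun_all (J : finType) (A : J -> finType) (P : forall j, pred (A j)) :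
  #|[pred phi : {dffun forall j, A j} | [forall j, P j (phi j)]]| =
  (\prod_j #|P j|)%N.
Proof.
pose B j : finType := {a : A j | P j a}.
pose h (psi : {dffun forall j, B j}) : {dffun forall j, A j} :=
  [ffun j => val (psi j)].
have h_inj : injective h.
  move=> psi psi' /ffunP hE; apply/ffunP => j; apply: val_inj.
  by have := hE j; rewrite !ffunE.
transitivity #|{dffun forall j, B j}|.
  rewrite -(card_imset predT h_inj); apply: eq_card => phi.
  rewrite inE; apply/forallP/imsetP => [Pphi|[psi _ ->] j]; last first.
    by rewrite ffunE; exact: valP.
  exists [ffun j => Sub (phi j) (Pphi j) : B j] => //.
  by apply/ffunP => j; rewrite !ffunE SubK.
rewrite card_dep_ffun foldrE big_map big_enum.
by apply: eq_bigr => j _; rewrite card_sig.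
Qed.

(** * Isomorphisms between grafted families *)

Section IsosBplus.
Variables (J J' : finType) (W : J -> finType) (W' : J' -> finType).
Variables (T : forall j, rtree_on (W j)) (T' : forall j, rtree_on (W' j)).

Definition branch_map : finType :=
  {s : {ffun J -> J'} & {dffun forall j, {ffun W j -> W' (s j)}}}.

(** The permutation of the branches moves the branch of [j] to the branch of
    [tag p j], and [tagged p j] says where each vertex of that branch goes. *)
Definition glue (p : branch_map) :
    {ffun option {j & W j} -> option {j & W' j}} :=
  [ffun o => omap (fun u => Tagged W' (tagged p (tag u) (tagged u))) o].

Lemma glue_None p : glue p None = None. Proof. by rewrite ffunE. Qed.

Lemma glue_Some p j (x : W j) :
  glue p (Some (Tagged W x)) = Some (Tagged W' (tagged p j x)).
Proof. by rewrite ffunE. Qed.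

Lemma glue_inj : injective glue.
Proof.
move=> [s f] [s' f'] /ffunP eq_g.
have eqE j (x : W j) : Tagged W' (f j x) = Tagged W' (f' j x).
  by have := eq_g (Some (Tagged W x)); rewrite !glue_Some => -[].
have ss' : s = s'.
  by apply/ffunP => j; have /(congr1 (@tag _ _)) := eqE j (root (T j)).
move: f' eqE {eq_g}; rewrite -{}ss' => f' eqE; congr Tagged.
by apply/ffunP => j; apply/ffunP => x; exact: Tagged_inj (eqE j x).
Qed.

(** Between finite sets of the same cardinal an injection is a bijection, so
    this asks [tag p] to be bijective. *)
Definition is_branch_iso (p : branch_map) : bool :=
  [&& injectiveb (tag p), #|J| == #|J'|
    & [forall j, is_iso (T j) (T' (tag p j)) (tagged p j)]].

Lemma glue_iso p : is_branch_iso p -> is_iso (bplus T) (bplus T') (glue p).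
Proof.
case: p => s f /and3P[/= /injectiveP s_inj /eqP JJ' /forallP fP].
have [t sK tK] := inj_card_bij s_inj (eq_leq (esym JJ')).
apply/is_isoP; split; last 2 first.
- exact: glue_None.
- move=> [[j x]|] [[k y]|]; rewrite ?glue_None ?glue_Some.
  + have [jk|jk] := eqVneq j k.
      move: y; rewrite -jk => y; rewrite !bplus_branchE /=.
      by have /is_isoP[_ _ ->] := fP j.
    by rewrite !bplus_arcE /= (inj_eq s_inj) (negbTE jk).
  + rewrite !bplus_rootE /=; have /is_isoP[bf <- _] := fP j.
    by rewrite (bij_eq bf).
  + by rewrite !bplus_arcE.
  + by rewrite !bplus_arcE.
apply: inj_surj_bij => [[[j x]|] [[k y]|]|[[c y]|]];
  rewrite ?glue_None ?glue_Some //=.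
- move=> eq_fxy; have jk : j = k.
    by apply: s_inj; have /(congr1 (@tag _ _)) := Some_inj eq_fxy.
  move: y eq_fxy; rewrite -jk => y eq_fxy; congr Some; congr Tagged.
  have /is_isoP[bf _ _] := fP j; apply: (bij_inj bf).
  exact: Tagged_inj (Some_inj eq_fxy).
- move: y; rewrite -[c]tK => y; have /is_isoP[[g fK gK] _ _] := fP (t c).
  exists (Some (Tagged W (g y))).
  by rewrite glue_Some /= gK.
- by exists None; rewrite glue_None.
Qed.

(** An isomorphism maps root to root, hence children of the root to children of
    the root, and the branch hanging from a child follows that child: adjacent
    vertices other than the root lie in the same branch. *)
Lemma iso_glue h : is_iso (bplus T) (bplus T') h ->
  exists2 p, is_branch_iso p & h = glue p.
Proof.
case/is_isoP => -[h' hK h'K] hr hE.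
have hN : h None = None by exact: hr.
have /choice[g gE] u : exists v, h (Some u) = Some v.
  case hu : (h (Some u)) => [v|]; first by exists v.
  by have := hK (Some u); rewrite hu -[None in h' None]hN hK.
pose rt j := Tagged W (root (T j)).
have [s sE] : exists s : {ffun J -> J'}, forall j, s j = tag (g (rt j)).
  by exists [ffun j => tag (g (rt j))] => j; rewrite ffunE.
(* The index of the target branch is constant along the path from x to the
   root of its branch. *)
have htag j (x : W j) : {y : W' (s j) | h (Some (Tagged W x)) = Some (Tagged W' y)}.
  apply: cid; suff sj : tag (g (Tagged W x)) = s j.
    rewrite -sj gE; exists (tagged (g (Tagged W x))).
    by case: (g _).
  rewrite sE /rt; case/connectP: (root_connect (T j) x) => p.
  elim: p x => [|y p IHp] x /=; first by move=> _ <-.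
  case/andP=> xy yp def_r; rewrite -(IHp y yp def_r).
  have: (Some (Tagged W x), Some (Tagged W y)) \in arcs (bplus T).
    by rewrite bplus_branchE.
  by rewrite -hE !gE bplus_arcE => /andP[/eqP].
pose f : {dffun forall j, {ffun W j -> W' (s j)}} :=
  [ffun j => [ffun x => sval (htag j x)]].
have fE j (x : W j) : h (Some (Tagged W x)) = Some (Tagged W' (f j x)).
  by rewrite !ffunE; exact: svalP (htag j x).
have fr j : f j (root (T j)) = root (T' (s j)).
  apply/eqP; rewrite -bplus_rootE -fE -[X in (_, X)]hN hE bplus_rootE.
  exact: eqxx.
have s_inj : injective s.
  move=> j k sjk; have : h (Some (rt j)) = h (Some (rt k)) by rewrite !fE !fr sjk.
  by move/(can_inj hK)/Some_inj/(congr1 (@tag _ _)).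
have hpre c (y : W' c) : exists2 u, h (Some u) = Some (Tagged W' y)
    & s (tag u) = c.
  case def_u : (h' (Some (Tagged W' y))) => [[j x]|]; last first.
    by have := h'K (Some (Tagged W' y)); rewrite def_u hN.
  exists (Tagged W x); first by rewrite -def_u h'K.
  have := h'K (Some (Tagged W' y)); rewrite def_u fE.
  by move/Some_inj/(congr1 (@tag _ _)).
exists (Tagged (fun s : {ffun J -> J'} =>
    {dffun forall j, {ffun W j -> W' (s j)}}) f); last first.
  by apply/ffunP => -[[j x]|]; rewrite ?glue_None // glue_Some fE.
apply/and3P; split; first exact/injectiveP.
  apply/eqP/(bij_eq_card (f := s))/inj_surj_bij => // c.
  by have [u _ <-] := hpre c (root (T' c)); exists (tag u).
apply/forallP => j /=; apply/is_isoP; split; last 2 first.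
- exact: fr.
- by move=> x y; rewrite -bplus_branchE -!fE hE bplus_branchE.
apply: inj_surj_bij => [x y fxy|y].
  have : h (Some (Tagged W x)) = h (Some (Tagged W y)) by rewrite !fE fxy.
  by move/(can_inj hK)/Some_inj/Tagged_inj.
have [[k x] hx /s_inj /= kj] := hpre _ y.
move: x hx; rewrite kj => x; rewrite fE => /Some_inj/Tagged_inj <-.
by exists x.
Qed.

(** This replaces the usual formula for the automorphism group of a tree with
    repeated branches: no multiplicity of a branch occurs, since branches are
    matched by bijections of the index sets. *)
Lemma card_isos_bplus : #|isos (bplus T) (bplus T')| =
  (\sum_(s : {ffun J -> J'} | injectiveb s && (#|J| == #|J'|))
     \prod_j #|isos (T j) (T' (s j))|)%N.
Proof.
transitivity #|is_branch_iso|.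
  rewrite -(card_imset _ glue_inj); apply: eq_card => h; rewrite inE.
  apply/idP/imsetP => [/iso_glue[p pP ->]|[p pP ->]]; first by exists p.
  exact: glue_iso.
have cardE (s : {ffun J -> J'}) : (\prod_j #|isos (T j) (T' (s j))| =
    \sum_(f : {dffun forall j, {ffun W j -> W' (s j)}}
             | [forall j, is_iso (T j) (T' (s j)) (f j)]) 1)%N.
  rewrite sum1_card (card_dffun_all (fun j => is_iso (T j) (T' (s j)))).
  by apply: eq_bigr => j _; apply: eq_card => f; rewrite inE.
under eq_bigr do rewrite cardE.
rewrite sig_big_dep -sum1_card; apply: eq_bigl => p.
by rewrite -andbA.
Qed.

End IsosBplus.
(** * Every tree is a grafted family *)

Section Relabel.
Variables (V W : finType) (T : rtree_on V) (f : V -> W).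
Hypothesis f_bij : bijective f.

Definition relabel_val : W * {set W * W} :=
  (f (root T), [set (f a.1, f a.2) | a in arcs T]).

Lemma relabel_arcE w v :
  ((f w, f v) \in relabel_val.2) = ((w, v) \in arcs T).
Proof.
have f_inj := bij_inj f_bij.
apply/imsetP/idP => [[[a b] /= ab [/f_inj -> /f_inj ->]] //|wv].
by exists (w, v).
Qed.

Fact relabel_is_rtree : is_rtree relabel_val.
Proof.
have [g fK gK] := f_bij.
apply: is_rtreeI => [v|v w w'|w].
- rewrite -[v]gK; apply: homo_connect (root_connect T (g v)) => x y xy.
  by rewrite /arc_rel relabel_arcE.
- rewrite -[v]gK -[w]gK -[w']gK !relabel_arcE => vw vw'.
  by rewrite (arc_functional vw vw').
- by rewrite -[w]gK relabel_arcE root_no_arc.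
Qed.

Definition relabel : rtree_on W := RTree relabel_is_rtree.

Lemma iso_relabel : iso T relabel.
Proof. by apply/isoP; exists f; split=> // w v; exact: relabel_arcE. Qed.

End Relabel.

Lemma iso_rep_class n (T : rtree_on 'I_n.+1) : iso (rep (class T)) T.
Proof.
pose T' := existT (fun k => rtree_on 'I_k.+1) n T.
have : ord_iso (repr (class T)) T' by rewrite -(@eqmodE _ ord_iso_equiv) reprK.
by [].
Qed.

Lemma rep_iso_inj (T T' : rtree) : iso (rep T) (rep T') -> T = T'.
Proof.
move=> TT'; rewrite -[T]reprK -[T']reprK; apply/eqP.
by rewrite (@eqmodE _ ord_iso_equiv).
Qed.

Lemma exists_rep (V : finType) (T : rtree_on V) : exists T', iso T (rep T').
Proof.
have V_gt0 : (0 < #|V|)%N by apply/card_gt0P; exists (root T).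
have eqV : #|V| = #|V|.-1.+1 by rewrite prednK.
pose f v := cast_ord eqV (enum_rank v).
have f_bij : bijective f.
  exists (fun i => enum_val (cast_ord (esym eqV) i)) => x; rewrite /f.
    by rewrite cast_ordK enum_rankK.
  by rewrite enum_valK cast_ordKV.
exists (class (relabel T f_bij)).
apply: iso_trans (iso_relabel T f_bij) _.
by rewrite iso_sym; exact: iso_rep_class.
Qed.

Section Branches.
Variables (V : finType) (T : rtree_on V).

Section Branch.
Variable c : V.

Definition branch_vert : finType := {v : V | connect (arc_rel (arcs T)) v c}.

Definition branch_val : branch_vert * {set branch_vert * branch_vert} :=
  (exist _ c (connect0 _ c),
   [set a : branch_vert * branch_vert | (val a.1, val a.2) \in arcs T]).

(** The only delicate point is that the arc leaving [c] does not stay inside the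
    branch, which holds because the depth decreases along it. *)
Fact branch_is_rtree : is_rtree branch_val.
Proof.
apply: is_rtreeI => [[v vc]|u v w|w].
- case/connectP: (vc) => p; elim: p v vc => [|w p IHp] v vc /=.
    by move=> _ def_c; rewrite (_ : exist _ v vc = branch_val.1); last exact: val_inj.
  case/andP=> vw wp def_c.
  have wc : connect (arc_rel (arcs T)) w c by apply/connectP; exists p.
  apply: connect_trans (IHp w wc wp def_c).
  by apply: connect1; rewrite /arc_rel inE.
- by rewrite !inE /= => uv uw; apply: val_inj; exact: arc_functional uv uw.
- rewrite inE /=; case: w => w /= wc; apply/negP => cw.
  have [d dP] := depth_exists T.
  have d_le x y : connect (arc_rel (arcs T)) x y -> (d y <= d x)%N.
    case/connectP=> p; elim: p x => [|z p IHp] x /=; first by move=> _ ->.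
    by case/andP=> xz zp /(IHp z zp) dz; rewrite (dP x z xz) ltnW.
  by have := d_le _ _ wc; rewrite (dP c w cw) ltnn.
Qed.

Definition branch : rtree_on branch_vert := RTree branch_is_rtree.

End Branch.

Definition child : finType := {c : V | (c, root T) \in arcs T}.

(** Each vertex but the root lies above exactly one child of the root: the path
    to the root enters it through a child, and two such children would be
    comparable by [connect_chain]. *)
Lemma iso_bplus_branch : iso (bplus (fun c : child => branch (val c))) T.
Proof.
pose W (c : child) := branch_vert (val c).
pose f (o : option {c : child & W c}) : V :=
  if o is Some u then val (tagged u) else root T.
have child_connect (c c' : child) :
    connect (arc_rel (arcs T)) (val c) (val c') -> c = c'.
  case: c c' => [c cr] [c' cr'] /= /connectP[[_ /= eq_c|w p /= /andP[cw wp] def_c']].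
    by apply: val_inj; rewrite /= eq_c.
  move: wp def_c'; rewrite -(arc_functional cr cw) => wp def_c'.
  have c'r : c' = root T by apply: connect_root; apply/connectP; exists p.
  by have := root_no_arc T (root T); rewrite -{1}c'r cr'.
have child_uniq v (c c' : child) : connect (arc_rel (arcs T)) v (val c) ->
    connect (arc_rel (arcs T)) v (val c') -> c = c'.
  move=> vc vc'; have [|] := connect_chain vc vc'; first exact: child_connect.
  by move/child_connect.
have not_root (c : child) v : connect (arc_rel (arcs T)) v (val c) -> v <> root T.
  case: c => c cr /= vc vr; rewrite vr in vc; have := root_no_arc T (root T).
  by rewrite -{1}(connect_root vc) cr.
apply/isoP; exists f; split=> //; last first.
  move=> [[c [w wc]]|] [[c' [v vc']]|]; rewrite bplus_arcE /=.
  - have [cc'|cc'] := eqVneq c c'.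
      by move: vc'; rewrite -cc' => vc; rewrite tagged_asE inE.
    apply/negP => wv; case/eqP: cc'; apply: (child_uniq w) => //.
    by apply: (connect_trans (connect1 _) vc').
  - rewrite -val_eqE /=; apply/idP/eqP => [wr|->]; last exact: (valP c).
    case/connectP: wc => -[//|u p] /= /andP[wu up] def_c.
    have uc : connect (arc_rel (arcs T)) u (val c) by apply/connectP; exists p.
    by case: (not_root c u uc); exact: arc_functional wu wr.
  - exact/negbTE/root_no_arc.
  - exact/negbTE/root_no_arc.
apply: inj_surj_bij => [[[c [v vc]]|] [[c' [w wc']]|]|v] //=.
- move=> vw; move: wc'; rewrite -{}vw => vc'.
  have cc' := child_uniq v c c' vc vc'.
  by move: vc'; rewrite -cc' => vc'; congr (Some (Tagged _ _)); exact: val_inj.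
- by move/(not_root c v vc).
- by move/esym/(not_root c' w wc').
have [->|vr] := eqVneq v (root T); first by exists None.
suff [c vc] : exists c : child, connect (arc_rel (arcs T)) v (val c).
  by exists (Some (Tagged W (Sub v vc : W c))).
case/connectP: (root_connect T v) => p; elim: p v vr => [|w p IHp] v vr /=.
  by move=> _ def_r; rewrite def_r eqxx in vr.
case/andP=> vw wp def_r; have [wr|wr] := eqVneq w (root T).
  have vr' : (v, root T) \in arcs T by rewrite -wr.
  by exists (Sub v vr' : child); exact: connect0.
have [c wc] := IHp w wr wp def_r; exists c.
by apply: connect_trans wc; apply: connect1.
Qed.

End Branches.

Lemma iso_bplus (J : finType) (W W' : J -> finType)
    (T : forall j, rtree_on (W j)) (T' : forall j, rtree_on (W' j)) :
  (forall j, iso (T j) (T' j)) -> iso (bplus T) (bplus T').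
Proof.
move=> TT'; rewrite -isos_gt0 card_isos_bplus (bigD1 [ffun j => j]) /=; last first.
  by rewrite eqxx andbT; apply/injectiveP => x y; rewrite !ffunE.
rewrite addn_gt0 prodn_gt0 // => j; rewrite ffunE isos_gt0; exact: TT'.
Qed.

Lemma exists_bplus (V : finType) (T : rtree_on V) :
  exists (C : finType) (T0 : C -> rtree), iso (bplus (fun c => rep (T0 c))) T.
Proof.
have /choice[T0 T0P] (c : child T) := exists_rep (branch T (val c)).
exists (child T), T0; apply: iso_trans (iso_bplus_branch T).
by rewrite iso_sym; exact: iso_bplus.
Qed.
(** * Generating series of weighted sets *)

Section WeightedSets.
Lemma fcoef_sum (I : finType) (P : pred I) (F : I -> coefs) n :
  fcoef (\sum_(i | P i) F i) n = \sum_(i | P i) fcoef (F i) n.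
Proof. by elim/big_rec2: _ => //= i x y _ <-. Qed.

Definition eq_upto (e : nat) (f g : coefs) :=
  forall n, (n <= e)%N -> fcoef f n = fcoef g n.

Lemma eq_upto_prod e (I : finType) (F G : I -> coefs) :
  (forall i, eq_upto e (F i) (G i)) -> eq_upto e (\prod_i F i) (\prod_i G i).
Proof.
move=> FG; elim/big_rec2: _ => // i f g _ fg n le_ne /=.
apply: eq_bigr => k _; congr (_ * _); first apply: FG.
  by apply: leq_trans le_ne; rewrite -ltnS.
by apply: fg; apply: leq_trans (leq_subr _ _) le_ne.
Qed.

Definition fps_mono (w s : nat) : coefs :=
  Fps (fun n => if n == w then 'X^s : {poly rat} else 0).

Lemma fps_mono0 : fps_mono 0 0 = 1.
Proof. by apply/fpsP => n /=; rewrite expr0; case: eqP. Qed.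

Lemma fps_monoM w s w' s' : fps_mono w s * fps_mono w' s' = fps_mono (w + w') (s + s').
Proof.
apply/fpsP => n /=; have [le_wn|lt_nw] := leqP w n; last first.
  rewrite big1 => [|i _].
    by rewrite ifN // neq_ltn (leq_trans lt_nw) ?leq_addr.
  by rewrite ifN ?mul0r // neq_ltn (leq_trans (ltn_ord i)).
rewrite (bigD1 (Ordinal (le_wn : (w < n.+1)%N))) //= eqxx big1 => [|i iw].
  rewrite addr0 -(eqn_add2l w) subnKC //.
  by case: eqP; rewrite ?mulr0 // -exprD.
by rewrite ifN ?mul0r.
Qed.

Lemma prod_fps_mono (I : finType) (w s : I -> nat) :
  \prod_i fps_mono (w i) (s i) = fps_mono (\sum_i w i) (\sum_i s i).
Proof.
elim/big_rec3: _ => [|i x y z _ ->]; first by rewrite fps_mono0.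
by rewrite fps_monoM.
Qed.

(** Elements are counted by [t] to the weight [w] and [b] to the size [s].  As
    for [gen_flows], each coefficient is meaningful when the sets of elements of
    given weight are finite. *)
Definition gen_series (Y : choiceType) (A : set Y) (w s : Y -> nat) : coefs :=
  Fps (fun e => \sum_(y \in [set y | A y /\ w y = e]%classic)
                  ('X^(s y) : {poly rat})).

Lemma gen_series_bij (X Y : choiceType) (A : set X) (B : set Y) (h : X -> Y)
    (w s : X -> nat) (w' s' : Y -> nat) :
  set_bij A B h -> (forall x, A x -> w' (h x) = w x /\ s' (h x) = s x) ->
  gen_series A w s = gen_series B w' s'.
Proof.
move=> [hAB h_inj h_surj] hE; apply/fpsP => e /=.
rewrite (@reindex_fsbig _ _ _ _ _ h [set x | A x /\ w x = e]%classic).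
  by apply: eq_fsbigr => x /set_mem[/hE[_ ->]].
split=> [x [Ax <-]|x x'|y [By <-]] /=.
- by split; [exact: hAB | case: (hE x Ax)].
- by move=> /set_mem[Ax _] /set_mem[Ax' _]; apply: h_inj; exact: mem_set.
- have [x Ax def_y] := h_surj y By; exists x => //=; split=> //.
  by rewrite -def_y; case: (hE x Ax).
Qed.

Lemma sum_fsbig (I : finType) (P : pred I) (F : I -> {poly rat}) :
  \sum_(i | P i) F i = \sum_(i \in [set` P]%classic) F i.
Proof.
apply: bigfs => [|i _]; first exact: index_enum_uniq.
by rewrite mem_index_enum.
Qed.

(** Only finitely many elements have weight at most [e], and they determine the
    coefficient of [t^e] on both sides; for a finite set of elements, expanding
    the product of sums of monomials gives the formula. *)
Lemma prod_gen_series (J : finType) (Y : choiceType) (B : J -> set Y) (w s : Y -> nat) :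
  (forall j e, finite_set [set y | B j y /\ w y = e]%classic) ->
  \prod_j gen_series (B j) w s =
  gen_series [set f : {ffun J -> Y} | forall j, B j (f j)]%classic
    (fun f => \sum_j w (f j))%N (fun f => \sum_j s (f j))%N.
Proof.
move=> B_fin; apply/fpsP => e.
have [X XP] : exists X : {fset Y}, forall j y, B j y -> (w y <= e)%N -> y \in X.
  have : finite_set (\bigcup_(p in [set: J * 'I_e.+1])
      [set y | B p.1 y /\ w y = p.2])%classic.
    by apply: bigcup_finite => // p _; exact: B_fin.
  case/finite_fsetP => X defX; exists X => j y By le_we.
  have : [set` X]%classic y.
    by rewrite -defX; exists (j, Ordinal (le_we : (w y < e.+1)%N)).
  by [].
pose g j : coefs :=
  \sum_(y : X | `[< B j (val y) >]) fps_mono (w (val y)) (s (val y)).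
have gE j : eq_upto e (gen_series (B j) w s) (g j).
  move=> n le_ne; rewrite /g fcoef_sum /=.
  pose P := [pred y | `[< B j y >] && (n == w y)].
  rewrite -big_mkcondr -(big_seq_fsetE _ X P (fun y => 'X^(s y))).
  symmetry; rewrite (@bigfs _ _ _ _ X P) ?fset_uniq //; last first.
    move=> y /andP[/asboolP By /eqP nw].
    by case/negP; apply: (XP j) => //; rewrite -nw.
  apply: eq_fsbigl; apply/seteqP; split=> y /=; rewrite /P unfold_in /=.
    by move=> /andP[/asboolP ? /eqP].
  by case=> By ->; rewrite asboolT ?eqxx.
rewrite (eq_upto_prod gE) // bigA_distr_big_dep fcoef_sum.
under eq_bigr do rewrite prod_fps_mono /=.
rewrite -big_mkcondr sum_fsbig /=; symmetry.
pose h (f : {ffun J -> X}) : {ffun J -> Y} := [ffun j => val (f j)].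
rewrite (@reindex_fsbig _ _ _ _ _ h
    [set` [pred f | f \in family (fun j (y : X) => `[< B j (val y) >])
                  & e == (\sum_j w (val (f j)))%N]]%classic).
  by apply: eq_fsbigr => f _; congr ('X^ _); apply: eq_bigr => j _; rewrite ffunE.
have hE f : (\sum_j w (h f j) = \sum_j w (val (f j)))%N.
  by apply: eq_bigr => j _; rewrite ffunE.
split=> [f|f f' _ _ /ffunP ff'|f [Bf sum_f]] /=.
- case/andP => /familyP Bf /eqP ->; split=> // j; rewrite ffunE.
  exact: asboolW (Bf j).
- by apply/ffunP => j; apply: val_inj; have := ff' j; rewrite !ffunE.
have fX j : f j \in X.
  by apply: (XP j) => //; rewrite -sum_f (bigD1 j) //= leq_addr.
have fE : h [ffun j => [` fX j]%fset] = f by apply/ffunP => j; rewrite !ffunE.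
exists [ffun j => [` fX j]%fset] => //=; apply/andP; split.
  by apply/familyP => j; rewrite ffunE unfold_in /=; exact: asboolT.
by rewrite -hE fE sum_f.
Qed.

End WeightedSets.
(** * Flows under isomorphism and grafting *)

(** Both the transport of a flow along an isomorphism and its restriction to a
    branch are of this form. *)
Definition pull (V W : finType) (h : V -> W) (F : preflow W) : preflow V :=
  (h @^-1: outputs F, [ffun v => inputs F (h v)], [ffun v => rate F (h v)]).

Section Pull.
Variables (V W : finType) (h : V -> W) (F : preflow W).

Lemma mem_outputs_pull v : (v \in outputs (pull h F)) = (h v \in outputs F).
Proof. by rewrite inE. Qed.

Lemma inputs_pull v : inputs (pull h F) v = inputs F (h v).
Proof. by rewrite ffunE. Qed.

Lemma rate_pull v : rate (pull h F) v = rate F (h v).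
Proof. by rewrite ffunE. Qed.

End Pull.

Lemma preflowP (V : finType) (F G : preflow V) :
  [/\ outputs F =i outputs G, inputs F =1 inputs G & rate F =1 rate G] ->
  F = G.
Proof.
move: F G => [[O m] r] [[O' m'] r'] [/= /setP OO' mm' rr'].
rewrite /outputs /= in OO'; rewrite OO'.
by congr (_, _, _); apply/ffunP.
Qed.

Lemma exit_rate_ge0 (V : finType) (T : rtree_on V) (F : preflow V) :
  is_flow T F -> 0 <= exit_rate T F.
Proof. by case/and3P=> _ _ /forallP/(_ (root T)). Qed.

Lemma gen_flows_series (V : finType) (T : rtree_on V) (P : pred (preflow V)) :
  gen_flows T P = gen_series [set F | is_flow T F && P F]%classic
    (fun F => `|exit_rate T F|%N) (fun F => #|outputs F|).
Proof.
apply/fpsP => e /=; apply: eq_fsbigl; apply/seteqP.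
split=> F /= => [/and3P[-> -> /eqP ->] //|[/andP[flF ->] <-]].
by rewrite flF /= gez0_abs ?exit_rate_ge0.
Qed.

Lemma finite_flows_absz (V : finType) (T : rtree_on V) e :
  finite_set [set F | is_flow T F /\ `|exit_rate T F|%N = e]%classic.
Proof.
apply: sub_finite_set (finite_flows T e) => F /= [flF <-].
by rewrite flF gez0_abs ?exit_rate_ge0 /=.
Qed.

Lemma card_preim_bij (V W : finType) (h : V -> W) (A : {set W}) :
  bijective h -> #|h @^-1: A| = #|A|.
Proof.
by move=> bh; rewrite on_card_preimset //; case: bh => g hK gK; exists g => x _.
Qed.

Section PullIso.
Variables (V W : finType) (T : rtree_on V) (U : rtree_on W) (h : V -> W).
Hypothesis (h_bij : bijective h) (hr : h (root T) = root U).
Hypothesis hE : forall w v, ((h w, h v) \in arcs U) = ((w, v) \in arcs T).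

Lemma pull_iso_flow F : is_flow T (pull h F) = is_flow U F.
Proof.
have [g hK gK] := h_bij.
have allE (P : pred W) : [forall v, P (h v)] = [forall w, P w].
  apply/forallP/forallP => Ph x; last exact: Ph.
  by rewrite -[x]gK; exact: Ph.
rewrite /is_flow /is_rate; congr [&& _, _ & _]; rewrite -[RHS]allE.
- by apply: eq_forallb => v; rewrite mem_outputs_pull inputs_pull.
- apply: eq_forallb => v; rewrite mem_outputs_pull inputs_pull rate_pull.
  rewrite [X in _ = (_ == _ + X)](big_inj _ (h := h)) => [||w _]; last 2 first.
  + exact: bij_inj.
  + by exists (g w).
  congr (_ == _ + _); apply: eq_big => w; first by rewrite /arc_rel hE.
  by rewrite rate_pull.
- by apply: eq_forallb => v; rewrite rate_pull.
Qed.

Lemma pull_iso_small F : is_small T (pull h F) = is_small U F.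
Proof. by rewrite /is_small mem_outputs_pull inputs_pull hr. Qed.

Lemma small_flows_transport : small_flows T = small_flows U.
Proof.
rewrite /small_flows !gen_flows_series; symmetry; apply: (gen_series_bij (h := pull h)).
  have [g hK gK] := h_bij.
  split=> [F|F G _ _ FG|F /= FT] /=.
  - by rewrite pull_iso_flow pull_iso_small.
  - apply: preflowP; split=> w; rewrite -[w]gK.
    + by rewrite -!mem_outputs_pull FG.
    + by rewrite -!inputs_pull FG.
    + by rewrite -!rate_pull FG.
  have FE : pull h (pull g F) = F.
    by apply: preflowP; split=> v; rewrite ?mem_outputs_pull ?inputs_pull ?rate_pull hK.
  by exists (pull g F) => //=; rewrite -pull_iso_flow -pull_iso_small FE.
move=> F _; rewrite /exit_rate rate_pull hr; split=> //.
exact: card_preim_bij.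
Qed.

End PullIso.

Lemma small_flows_iso (V W : finType) (T : rtree_on V) (U : rtree_on W) :
  iso T U -> small_flows T = small_flows U.
Proof. by case/isoP=> h [h_bij hr hE]; exact: small_flows_transport h_bij hr hE. Qed.

Section FlowsBplus.
Variables (J : finType) (W : J -> finType) (T : forall j, rtree_on (W j)).

Definition to_bplus j (x : W j) : option {j & W j} := Some (Tagged W x).

Lemma to_bplus_inj j : injective (@to_bplus j).
Proof. by move=> x y /Some_inj/Tagged_inj. Qed.

Lemma sum_bplus_branch (R : nmodType) (F : option {j & W j} -> R) j (x : W j) :
  \sum_(o | arc_rel (arcs (bplus T)) o (to_bplus x)) F o =
  \sum_(y | arc_rel (arcs (T j)) y x) F (to_bplus y).
Proof.
rewrite (big_inj _ (h := @to_bplus j)) => [||[[k y]|]].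
- by apply: eq_bigl => y; rewrite /arc_rel bplus_branchE.
- exact: to_bplus_inj.
- rewrite /arc_rel bplus_arcE => /andP[/eqP/= kj _]; move: y; rewrite kj => y.
  by exists y.
- by rewrite /arc_rel bplus_arcE.
Qed.

Lemma sum_bplus_root (R : nmodType) (F : option {j & W j} -> R) :
  \sum_(o | arc_rel (arcs (bplus T)) o None) F o =
  \sum_j F (to_bplus (root (T j))).
Proof.
rewrite (big_inj _ (h := fun j => to_bplus (root (T j)))) => [|j k|[[k y]|]].
- by apply: eq_bigl => j; rewrite /arc_rel bplus_rootE eqxx.
- by move/Some_inj/(congr1 (@tag _ _)).
- by rewrite /arc_rel bplus_rootE => /eqP ->; exists k.
- by rewrite /arc_rel bplus_arcE.
Qed.

Definition restr (G : preflow (option {j & W j})) j : preflow (W j) :=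
  pull (@to_bplus j) G.

(** With neither input nor output at the root, the rate condition there only says
    that the root collects what the branches emit, and this sum is nonnegative
    since each term is. *)
Lemma is_flow_bplus G : is_small (bplus T) G ->
  reflect ((forall j, is_flow (T j) (restr G j)) /\
           rate G None = \sum_j exit_rate (T j) (restr G j))
    (is_flow (bplus T) G).
Proof.
case/andP=> /negbTE O_root /eqP m_root; apply: (iffP and3P).
  case=> /forallP OG /forallP rG /forallP r_ge0; split=> [j|].
    apply/and3P; split; apply/forallP => x.
    + rewrite mem_outputs_pull inputs_pull; exact: OG.
    + rewrite mem_outputs_pull inputs_pull rate_pull.
      rewrite (eqP (rG (to_bplus x))) sum_bplus_branch; apply/eqP; congr (_ + _).
      by apply: eq_bigr => y _; rewrite rate_pull.
    + by rewrite rate_pull.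
  rewrite (eqP (rG None)) O_root m_root subrr add0r sum_bplus_root.
  by apply: eq_bigr => j _; rewrite /exit_rate rate_pull.
case=> flG rate_root.
have restr_flow j :
  [/\ forall x, (to_bplus x \in outputs G) ==> (inputs G (@to_bplus j x) == 0%N),
      is_rate (T j) (restr G j) & forall x, 0 <= rate G (@to_bplus j x)].
  have /and3P[/forallP OG rG /forallP r_ge0] := flG j; split=> // x.
    by have := OG x; rewrite mem_outputs_pull inputs_pull.
  by have := r_ge0 x; rewrite rate_pull.
have r_ge0 j x : 0 <= rate G (@to_bplus j x) by have [_ _] := restr_flow j.
split; apply/forallP => -[[j x]|].
- by have [OG _ _] := restr_flow j; exact: OG.
- by rewrite [None \in _]O_root.
- have [_ /forallP/(_ x) rG _] := restr_flow j.
  rewrite mem_outputs_pull inputs_pull rate_pull in rG.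
  rewrite [rate G _](eqP rG) sum_bplus_branch; apply/eqP; congr (_ + _).
  by apply: eq_bigr => y _; rewrite rate_pull.
- rewrite [_ \in _]O_root [inputs _ _]m_root subrr add0r sum_bplus_root rate_root.
  by apply/eqP/eq_bigr => j _; rewrite /exit_rate rate_pull.
- exact: r_ge0.
- by rewrite rate_root sumr_ge0 // => j _; rewrite /exit_rate rate_pull.
Qed.

Lemma card_bplus_set (A : {set option {j & W j}}) : None \notin A ->
  #|A| = (\sum_j #|@to_bplus j @^-1: A|)%N.
Proof.
move=> AN; rewrite -sum1_card.
rewrite (big_inj _ (h := Some)) => [|u v []//|[u|]]; last 2 first.
- by exists u.
- by rewrite (negbTE AN).
under [RHS]eq_bigr do rewrite -sum1_card.
by rewrite sig_big_dep; apply: eq_bigl => -[j x]; rewrite inE.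
Qed.

Let branch_flow : choiceType := {j : J & preflow (W j)}.
Let tag_flow j (F : preflow (W j)) : branch_flow := Tagged (fun j => preflow (W j)) F.

(** A small flow is a free choice of a flow on each branch; sizes and exit rates
    add up over the branches.  Preflows on different branches have different
    types, so families of them are encoded as functions into the disjoint union
    [branch_flow]. *)
Lemma small_flows_bplus : small_flows (bplus T) = \prod_j flows (T j).
Proof.
pose B j : set branch_flow :=
  [set y | exists2 F, is_flow (T j) F & y = tag_flow F]%classic.
pose w (y : branch_flow) := `|exit_rate (T (tag y)) (tagged y)|%N.
pose s (y : branch_flow) := #|outputs (tagged y)|.
have flowsE j : flows (T j) = gen_series (B j) w s.
  rewrite /flows gen_flows_series; apply: (gen_series_bij (h := @tag_flow j)) => //.
  split=> [F /= /andP[flF _]|F G _ _ /Tagged_inj //|y [F flF ->]].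
    by exists F.
  by exists F => //=; rewrite flF.
under [RHS]eq_bigr do rewrite flowsE.
rewrite prod_gen_series => [|j e]; last first.
  apply: (@sub_finite_set _ _ ((@tag_flow j) @`
    [set F | is_flow (T j) F /\ `|exit_rate (T j) F|%N = e])%classic).
    by move=> y [[F flF ->] wF]; exists F.
  exact/finite_image/finite_flows_absz.
rewrite /small_flows gen_flows_series.
pose split_flow G : {ffun J -> branch_flow} := [ffun j => tag_flow (restr G j)].
have restrE G G' j : split_flow G = split_flow G' -> restr G j = restr G' j.
  by move/ffunP/(_ j); rewrite !ffunE => /Tagged_inj.
apply: (gen_series_bij (h := split_flow)) => [|G /= /andP[flG smG]]; last first.
  have [flGj rG] := is_flow_bplus smG flG; split.
    apply/eqP; rewrite -eqz_nat gez0_abs ?exit_rate_ge0 //.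
    rewrite [exit_rate _ _]rG -natz natr_sum; apply/eqP/eq_bigr => j _.
    by rewrite natz ffunE gez0_abs // exit_rate_ge0.
  rewrite (card_bplus_set (andP smG).1); apply: eq_bigr => j _.
  by rewrite ffunE.
split=> [G /= /andP[flG smG] j|
         G G' /set_mem/andP[flG smG] /set_mem/andP[flG' smG'] GG'|f fB].
- have [flGj _] := is_flow_bplus smG flG.
  by rewrite ffunE; exists (restr G j).
- have [_ rG] := is_flow_bplus smG flG; have [_ rG'] := is_flow_bplus smG' flG'.
  have /andP[/negbTE OG /eqP mG] := smG; have /andP[/negbTE OG' /eqP mG'] := smG'.
  apply: preflowP; split=> -[[j x]|].
  + by rewrite -!(mem_outputs_pull (@to_bplus j)) [pull _ _](restrE _ _ j GG').
  + exact: etrans OG (esym OG').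
  + by rewrite -!(inputs_pull (@to_bplus j)) [pull _ _](restrE _ _ j GG').
  + exact: etrans mG (esym mG').
  + by rewrite -!(rate_pull (@to_bplus j)) [pull _ _](restrE _ _ j GG').
  + by rewrite rG rG'; apply: eq_bigr => j _; rewrite (restrE _ _ j GG').
have {}fB j : {F | is_flow (T j) F & f j = tag_flow F} by apply: cid2; exact: fB.
pose F j := s2val (fB j).
pose G : preflow (option {j & W j}) :=
  ([set o | if o is Some u then tagged u \in outputs (F (tag u)) else false],
   [ffun o => if o is Some u then inputs (F (tag u)) (tagged u) else 0%N],
   [ffun o => if o is Some u then rate (F (tag u)) (tagged u)
              else \sum_j exit_rate (T j) (F j)]).
have restrG j : restr G j = F j.
  apply: preflowP; split=> x.
  - by rewrite mem_outputs_pull inE.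
  - by rewrite inputs_pull ffunE.
  - by rewrite rate_pull ffunE.
have smG : is_small (bplus T) G by rewrite /is_small inE ffunE.
exists G => /=; last first.
  by apply/ffunP => j; rewrite ffunE restrG -(s2valP' (fB j)).
rewrite smG andbT; apply/is_flow_bplus => //; split=> [j|].
  by rewrite restrG; exact: s2valP (fB j).
by rewrite ffunE; apply: eq_bigr => j _; rewrite restrG.
Qed.

End FlowsBplus.
(** * Grafting along a corolla *)

Section GraftStar.
Variables (V : finType) (S : rtree_on V).
Hypothesis starS : forall w v,
  ((w, v) \in arcs S) = (w != root S) && (v == root S).

Definition leaf : finType := {i : V | i != root S}.

Section Graft.
Variables (W : V -> finType) (T : forall i, rtree_on (W i)).
Hypothesis W_root : #|W (root S)| = 1%N.

Lemma vert_root_uniq (x y : W (root S)) : x = y.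
Proof. by have /eqP/fintype1P[z xz] := W_root; rewrite (xz x) (xz y). Qed.

(** Every edge ends at the root, where there is a single vertex to graft on. *)
Lemma card_graft_choice : #|graft_choice S W| = 1%N.
Proof.
rewrite card_dep_ffun foldrE big_map big_enum big1 // => -[[w v] /= wv] _.
by move: (wv); rewrite starS => /andP[_ /eqP ->].
Qed.

Lemma iso_graft_star (f : graft_choice S W) :
  iso (bplus (fun j : leaf => T (val j))) (graft T f).
Proof.
pose h (o : option {j : leaf & W (val j)}) : {i : V & W i} :=
  if o is Some u then Tagged W (tagged u) else Tagged W (root (T (root S))).
apply/isoP; exists h; split=> //; last first.
  move=> [[[j jr] x]|] [[[k kr] y]|].
  - rewrite bplus_arcE /=.
    apply/in_graft_arcs/andP => [[[y' xy' yy']|[[[e e'] /= ee'] _ yf]]|].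
    + have kj : k = j by exact: (congr1 (@tag _ _) yy').
      move: kr y yy'; rewrite kj => kr y /Tagged_inj ->.
      rewrite (bool_irrelevance kr jr) tagged_asE; split=> //.
    + have /= ke := congr1 (@tag _ _) yf.
      by have := ee'; rewrite starS -ke (negbTE kr) andbF.
    + case=> /eqP jk; left.
      have {jk} jk := congr1 val jk; simpl in jk.
      move: kr y b; rewrite -jk => kr y; rewrite (bool_irrelevance kr jr) tagged_asE.
      by exists y.
  - rewrite bplus_rootE; apply/in_graft_arcs/eqP => [[[y' _ yy']|[e xe _]]|->].
    + by have /= jE := congr1 (@tag _ _) yy'; move: (jr); rewrite jE eqxx.
    + have /= je := congr1 (@tag _ _) xe.
      by move: x xe; rewrite /= je => x /Tagged_inj.
    + have jS : (j, root S) \in arcs S by rewrite starS jr eqxx.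
      right; exists (exist _ (j, root S) jS) => //=; congr Tagged.
      exact: vert_root_uniq.
  - by rewrite bplus_arcE; apply/negbTE/(root_no_arc (graft T f)).
  - by rewrite bplus_arcE; apply/negbTE/(root_no_arc (graft T f)).
apply: inj_surj_bij => [[[[j jr] x]|] [[[k kr] y]|]|[i x]] //=.
- move=> xy; have /= jk := congr1 (@tag _ _) xy.
  move: jr x xy; rewrite jk => jr x /Tagged_inj ->.
  by rewrite (bool_irrelevance kr jr).
- by move/(congr1 (@tag _ _)) => /= jE; have /eqP := jr.
- by move/(congr1 (@tag _ _)) => /= /esym kE; have /eqP := kr.
have [ir|ir] := eqVneq i (root S).
  exists None; move: x; rewrite ir => x; congr Tagged; exact: vert_root_uniq.
by exists (Some (Tagged (fun j : leaf => W (val j))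
  (x : W (val (exist _ i ir : leaf))))).
Qed.

End Graft.

Lemma graft_coef_star (T : V -> rtree) (U : rtree) : T (root S) = bullet ->
  graft_coef S T U = iso (bplus (fun j : leaf => rep (T (val j)))) (rep U).
Proof.
move=> Tr; have W_root : #|vert (T (root S))| = 1%N.
  by rewrite Tr (iso_card (iso_rep_class _)) card_ord.
have isoE (f : graft_choice S (fun i => vert (T i))) :
    iso (graft (fun i => rep (T i)) f) (rep U) =
    iso (bplus (fun j : leaf => rep (T (val j)))) (rep U).
  have TfT := iso_graft_star (fun i => rep (T i)) W_root f.
  by apply/idP/idP; apply: iso_trans; rewrite // iso_sym.
rewrite /graft_coef; case: (boolP (iso (bplus _) _)) isoE => _ isoE.
  apply: etrans (card_graft_choice (W := fun i => vert (T i)) W_root).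
  by apply: eq_card => f; rewrite !inE isoE.
by apply: eq_card0 => f; rewrite !inE isoE.
Qed.

End GraftStar.
(** * The coefficient of a tree *)

Lemma fps_scaleAl (a : {poly rat}) (f g : coefs) : a *: (f * g) = (a *: f) * g.
Proof.
apply/fpsP => n /=; rewrite mulr_sumr.
by apply: eq_bigr => i _; rewrite mulrA.
Qed.

Lemma scale_natK a (f : coefs) : (0 < a)%N ->
  ((a%:R : rat)^-1)%:P *: (f *+ a) = f.
Proof.
move=> a_gt0; rewrite -[f *+ a]scaler_nat scalerA -polyC_natr -polyCM.
by rewrite mulVf ?scale1r // pnatr_eq0 -lt0n.
Qed.

Lemma corolla_rep_star n w v :
  ((w, v) \in arcs (rep (corolla n))) =
  (w != root (rep (corolla n))) && (v == root (rep (corolla n))).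
Proof.
have /isoP[h [h_bij hr <-]] := iso_rep_class (RTree (corolla_is_rtree n)).
by rewrite inE /= -!(inj_eq (bij_inj h_bij)) hr.
Qed.

Lemma card_leaf_corolla n : #|leaf (rep (corolla n))| = n.
Proof.
rewrite card_sig; apply: etrans (cardC1 (root (rep (corolla n)))) _.
by rewrite (iso_card (iso_rep_class _)) card_ord.
Qed.

Lemma corolla_inj : injective corolla.
Proof. by move=> n m nm; rewrite -[n]card_leaf_corolla nm card_leaf_corolla. Qed.

(** Weighting each tree by the isomorphisms to a fixed one cancels the division by
    [aut] in the series of flows. *)
Lemma flow_series_isos (T T' : rtree) :
  flow_series T *+ #|isos (rep T) (rep T')| =
  if T == T' then flows (rep T) else 0.
Proof.
have [<-|TT'] := eqVneq.
  rewrite card_isos_aut ?iso_refl // /flow_series scalerMnr scale_natK //.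
  by rewrite -(card_isos_aut (iso_refl _)) isos_gt0 iso_refl.
rewrite (_ : #|_| = 0%N) ?mulr0n //; apply/eqP; rewrite -leqn0 leqNgt isos_gt0.
by apply: contraNN TT' => /rep_iso_inj ->.
Qed.

Section ApplyStar.
Variables (V : finType) (S : rtree_on V).
Hypothesis starS : forall w v,
  ((w, v) \in arcs S) = (w != root S) && (v == root S).
Variables (U : rtree) (C : finType) (T0 : C -> rtree).
Hypothesis T0_U : iso (bplus (fun c => rep (T0 c))) (rep U).

Let a i := if i == root S then tree bullet else flow_series.

Let leaf_bij : pred {ffun leaf S -> C} :=
  [pred s | injectiveb (s : {ffun _ -> _}) && (#|leaf S| == #|C|)].

(** The family of trees that a matching [s] of the leaves of [S] with the branches
    of [U] assigns to the vertices of [S]. *)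
Definition hang (s : {ffun leaf S -> C}) : {ffun V -> rtree} :=
  [ffun i => if insub i is Some j then T0 (s j) else bullet].

Lemma hang_root s : hang s (root S) = bullet.
Proof. by rewrite ffunE insubF ?eqxx. Qed.

Lemma hang_leaf s j : hang s (val j) = T0 (s j).
Proof. by rewrite ffunE valK. Qed.

(** Multiplying by [aut (rep U)] turns the indicator [graft_coef] into the number
    of isomorphisms from the grafted tree to [U].  These are indexed by a
    matching [s] of the leaves with the branches of [U] and an isomorphism from
    each [T j] to the branch of [s j], so that [flow_series_isos] applies
    to each factor. *)
Lemma apply_star_term (T : {ffun V -> rtree}) :
  (\prod_i a i (T i)) *+ graft_coef S T U *+ aut (rep U) =
  \sum_(s | leaf_bij s) if T == hang s then \prod_c flows (rep (T0 c)) else 0.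
Proof.
have [Tr|Tr] := eqVneq (T (root S)) bullet; last first.
  rewrite (bigD1 (root S)) //= /a eqxx /tree (negbTE Tr) mul0r !mul0rn.
  rewrite big1 // => s _; case: eqP => // Ts.
  by rewrite Ts hang_root eqxx in Tr.
have -> : \prod_i a i (T i) = \prod_(j : leaf S) flow_series (T (val j)).
  rewrite (bigD1 (root S)) //= {1}/a eqxx /tree Tr eqxx mul1r.
  rewrite (big_inj _ (h := val : leaf S -> V)) => [||i ir]; first last.
  - by exists (exist _ i ir).
  - exact: val_inj.
  by apply: eq_big => [j|j jr]; [exact: (valP j) | rewrite /a ifN].
rewrite -mulrnA (graft_coef_star starS _ Tr).
have -> : (iso (bplus (fun j : leaf S => rep (T (val j)))) (rep U) * aut (rep U) =
    #|isos (bplus (fun j : leaf S => rep (T (val j))))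
           (bplus (fun c => rep (T0 c)))|)%N.
  rewrite (card_isos_eq (iso_refl _) T0_U); case: (boolP (iso _ _)) => TU.
    by rewrite mul1n (card_isos_aut TU).
  by rewrite mul0n; apply/esym/eqP; rewrite -leqn0 leqNgt isos_gt0.
rewrite card_isos_bplus -sumrMnr.
apply: eq_bigr => s /andP[/injectiveP s_inj /eqP cardC].
rewrite -prodrMn; under eq_bigr do rewrite flow_series_isos.
have [T_s|/eqP T_s] := eqVneq T (hang s).
  rewrite (big_inj _ (h := s)) => [|//|c _]; last first.
    have [t sK tK] := inj_card_bij s_inj (eq_leq (esym cardC)).
    by exists (t c).
  by apply: eq_bigr => j _; rewrite T_s hang_leaf eqxx.
have [j /negbTE Tj] : exists j, T (val j) != T0 (s j).
  apply/existsP; rewrite -negb_forall; apply/negP => /forallP Tj; case: T_s.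
  apply/ffunP => i; have [->|ir] := eqVneq i (root S); first by rewrite hang_root.
  by have /eqP := Tj (exist _ i ir); rewrite -hang_leaf.
by rewrite (bigD1 j) //= Tj mul0r.
Qed.

(** Exchanging the sums, each matching [s] is compatible with the single family
    [hang s] and contributes the product of the series of flows of all branches
    of [U], which is its series of small flows. *)
Lemma apply_star : apply S a U *+ aut (rep U) = small_flows (rep U) *+ #|leaf_bij|.
Proof.
rewrite -mulr_natl /apply full_fsbig_distrr; last first.
  apply: sub_finite_set (finite_apply S a U) => T /= [_] /eqP.
  by [].
under eq_fsbigr => T _ do rewrite /= mulr_natl apply_star_term.
(* The families [hang s] support the sum over all families. *)
pose r := undup [seq hang s | s <- enum {ffun leaf S -> C}].
have hang_r s : hang s \in r by rewrite mem_undup map_f ?mem_enum.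
have -> : [set: {ffun V -> rtree}]%classic = [set` predT]%classic.
  by apply/seteqP; split.
rewrite -(@bigfs _ _ _ _ r predT) ?undup_uniq // => [|T _ Tr]; last first.
  by rewrite big1 // => s _; case: eqP => // Ts; rewrite Ts hang_r in Tr.
rewrite exchange_big /= -(small_flows_iso T0_U) small_flows_bplus -sumr_const.
apply: eq_bigr => s _.
rewrite (bigD1_seq (hang s)) ?undup_uniq //= eqxx [X in _ + X]big1 ?addr0 // => T.
by move/negbTE ->.
Qed.

End ApplyStar.

Theorem theorem3p1 :
  small_flow_series = diamond corolla_series (tree bullet) flow_series.
Proof.
apply/funext => U.
have [C [T0 T0_U]] := exists_bplus (rep U).
have aut_gt0 : (0 < aut (rep U))%N.
  by rewrite -(card_isos_aut (iso_refl _)) isos_gt0 iso_refl.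
pose a S i := if i == root (rep S) then tree bullet else flow_series.
have applyE n : apply (rep (corolla n)) (a (corolla n)) U *+ aut (rep U) =
    small_flows (rep U) *+ (if n == #|C| then n`! else 0%N).
  rewrite (apply_star (@corolla_rep_star n) T0_U) card_leaf_corolla; congr (_ *+ _).
  case: eqP => [nC|_]; last by apply: eq_card0 => s; rewrite !inE andbF.
  transitivity (#|C| ^_ #|leaf (rep (corolla n))|); last first.
    by rewrite card_leaf_corolla -nC ffactnn.
  by rewrite -card_inj_ffuns; apply: eq_card => s; rewrite !inE andbT.
(* The sum defining the series of corollas has a single nonzero term, as the
   corollas are pairwise distinct. *)
have corollaE n : corolla_series (corolla n) = (n`!%:R^-1)%:P *: (1 : coefs).
  rewrite /corolla_series -(fsbig_widen [set n]%classic) ?fsbig_set1.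
  - by rewrite /tree eqxx.
  - by [].
  - move=> m [_ /= mn]; rewrite /tree; case: eqP => [/corolla_inj nm|_].
      by case: mn; rewrite nm.
    by rewrite scaler0.
rewrite /diamond -(fsbig_widen [set corolla #|C|]%classic) ?fsbig_set1 //.
  rewrite corollaE -fps_scaleAl mul1r /small_flow_series.
  rewrite -[apply _ _ _](scale_natK _ aut_gt0) applyE eqxx scalerA mulrC -scalerA.
  by rewrite scale_natK ?fact_gt0.
move=> S [_ /= SC]; have [[n Sn]|SN] := pselect (exists n, S = corolla n).
  have nC : n != #|C| by apply/eqP => nC; apply: SC; rewrite Sn nC.
  rewrite Sn -[apply _ _ _](scale_natK _ aut_gt0) applyE (negbTE nC).
  by rewrite mulr0n scaler0 mulr0.
rewrite /corolla_series fsbig1 ?mul0r // => n _; rewrite /tree.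
by case: eqP => [Sn|_]; [case: SN; exists n | rewrite scaler0].
Qed.
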